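(* Let $q\ge1$ be an integer and let $X$ be a finite, connected, undirected, simple $(q+1)$-regular graph on $N=|V(X)|$ vertices with a fixed base point $x_0$. Let $0=\lambda_1\le\dots\le\lambda_N=\lambda_{\max}$ be the eigenvalues of the combinatorial Laplacian $\Delta_X$ with corresponding orthonormal eigenfunctions $\psi_1,\dots,\psi_N$. Let $a\in\mathbb{R}$ and $b\in\mathbb{R}\setminus\{0\}$ satisfy: $a\le0$ if $b>0$, and $a\le-|b|\max\{\lambda_{\max},(\sqrt q+1)^2\}$ if $b<0$. Set $c_{a,b}=\frac{2b\sqrt q}{b(q+1)-a}$, $d_{a,b}=b(q+1)-a$, and $\mu_j=b\lambda_j-a\ge0$ for $j=1,\dots,N$. Then for every positive integer $k$ and every $x\in V(X)$, $$\sum_{j=1}^N\mu_j^k\,\psi_j(x_0)\overline{\psi_j(x)}=d_{a,b}^k\sum_{m=0}^k(-1)^mb_m(x)\,q^{-m/2}\,I_m^{c_{a,b}}(k)$$ $$=d_{a,b}^k\left(\delta_{x_0=x}\,I_0^{c_{a,b}}(k)+2\sum_{m=1}^k(-1)^m\Big[T_m\Big(\frac{A}{2\sqrt q}\Big)\delta_{x_0}\Big](x)\,I_m^{c_{a,b}}(k)\right),$$ where $A$ is the adjacency matrix of $X$ and $T_m$ is the Chebyshev polynomial of the first kind. Moreover, if $X$ is vertex-transitive, then for every positive integer $k$ $$\sum_{j=1}^N\mu_j^k=d_{a,b}^k\left(N\,I_0^{c_{a,b}}(k)+2\sum_{m=1}^k(-1)^m\,\mathrm{Tr}\Big[T_m\Big(\frac{A}{2\sqrt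 q}\Big)\Big]\,I_m^{c_{a,b}}(k)\right).$$
   Context: Combinatorial Laplacian: $\Delta_Xf(x)=(q+1)f(x)-\sum_{y\sim x}f(y)$. $\delta_{x_0=x}$ equals $1$ if $x=x_0$ and $0$ otherwise; $\delta_{x_0}$ is the column vector indexed by $V(X)$ with entry $1$ at $x_0$ and $0$ elsewhere; for a column vector $\mathbf a$ indexed by $V(X)$, $\mathbf a(x)$ is its entry at $x$. Discrete $I$-Bessel function: for $t,n\in\mathbb{N}_0$ with $n\le t$ and $c\in\mathbb{C}$, $$I_n^c(t)=\sum_{\ell=0}^{\lfloor (t-n)/2\rfloor}\frac{t!}{\ell!\,(t-2\ell-n)!\,(n+\ell)!}\left(\frac c2\right)^{2\ell+n},$$ and $I_n^c(t)=0$ for $n>t$ (with $0^0=1$). A non-backtracking walk is a walk in which no edge is immediately followed by its reversal; $c_m(x)$ is the number of non-backtracking walks of length $m$ from $x_0$ to $x$. Put $b_0(x)=c_0(x)$, $b_1(x)=c_1(x)$, and for $m\ge2$ $$b_m(x)=c_m(x)+(1-q)\big(c_{m-2}(x)+c_{m-4}(x)+\dots+c_*(x)\big),$$ where $c_*(x)=c_0(x)$ if $m$ is even and $c_*(x)=c_1(x)$ if $m$ is odd. *)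

(* Defs.v *)
From mathcomp Require Import all_boot all_order all_fingroup all_algebra.
From mathcomp Require Import reals complex.

Set Implicit Arguments.
Unset Strict Implicit.
Unset Printing Implicit Defensive.

Import Order.TTheory GRing.Theory Num.Theory.
Local Open Scope ring_scope.

Section Graph.
Variables (V : finType) (e : rel V).

Definition simple_graph : Prop := symmetric e /\ irreflexive e.

Definition connected_graph : Prop := forall x y : V, connect e x y.

Definition regular_graph (d : nat) : Prop :=
  forall x : V, #|[set y | e x y]| = d.

Definition graph_automorphism (s : {perm V}) : Prop :=
  forall x y : V, e (s x) (s y) = e x y.

Definition vertex_transitive : Prop :=
  forall x y : V, exists2 s : {perm V}, graph_automorphism s & s x = y.

(* The vertices of a walk of length m starting at x are x :: p with
   p : m.-tuple V; [darts x p] lists the oriented edges it traverses. *)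
Definition darts (x : V) (p : seq V) : seq (V * V) :=
  pairmap (fun u v => (u, v)) x p.

Definition nonbacktracking (x : V) (p : seq V) : bool :=
  sorted (fun d d' : V * V => d' != (d.2, d.1)) (darts x p).

Definition nb_walks (x0 : V) (m : nat) (x : V) : nat :=
  #|[set p : m.-tuple V |
      [&& path e x0 p, last x0 p == x & nonbacktracking x0 p]]|.

Definition nb_coef (q : nat) (x0 : V) (m : nat) (x : V) : int :=
  if (m < 2)%N then (nb_walks x0 m x)%:Z
  else (nb_walks x0 m x)%:Z +
    (1 - q%:Z) * \sum_(1 <= i < m./2.+1) (nb_walks x0 (m - i.*2) x)%:Z.

Definition laplacian (R : pzRingType) (q : nat) (f : V -> R) (x : V) : R :=
  q.+1%:R * f x - \sum_(y | e x y) f y.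

End Graph.

(* Matrices indexed by a finite type V with n.+1 elements are encoded as
   'M_n.+1 along the enumeration of V, so that horner_mx applies to them. *)
Section VertexIndexing.
Variables (V : finType) (n : nat) (cardV : #|V| = n.+1).

Definition vertex_index (x : V) : 'I_n.+1 := cast_ord cardV (enum_rank x).

Definition index_vertex (i : 'I_n.+1) : V :=
  enum_val (cast_ord (esym cardV) i).

Definition adjacency_mx (R : pzRingType) (e : rel V) : 'M[R]_n.+1 :=
  \matrix_(i, j) (e (index_vertex i) (index_vertex j))%:R.

Definition vertex_delta (R : pzRingType) (x : V) : 'cV[R]_n.+1 :=
  \col_i (i == vertex_index x)%:R.

Definition vertex_entry (R : pzRingType) (v : 'cV[R]_n.+1) (x : V) : R :=
  v (vertex_index x) 0.

End VertexIndexing.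

(* Chebyshev polynomials of the first kind. *)
Fixpoint chebyshevT (R : nzRingType) (m : nat) : {poly R} :=
  match m with
  | 0 => 1
  | m1.+1 => match m1 with
             | 0 => 'X
             | m2.+1 => 2%:R *: 'X * chebyshevT R m1 - chebyshevT R m2
             end
  end.

(* Discrete I-Bessel function: [besselI n c t] is I_n^c(t). *)
Definition besselI (F : numFieldType) (n : nat) (c : F) (t : nat) : F :=
  if (n <= t)%N then
    \sum_(0 <= l < ((t - n)./2).+1)
      t`!%:R / (l`!%:R * (t - l.*2 - n)`!%:R * (n + l)`!%:R)
        * (c / 2%:R) ^+ (l.*2 + n)
  else 0.

Definition orthonormal_family (R : realType) (V : finType) (I : eqType)
    (psi : I -> V -> R[i]) : Prop :=
  forall i j : I, \sum_(x : V) psi i x * conjc (psi j x) = (i == j)%:R.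

(* Main.v *)
Require Import Defs.
From mathcomp Require Import all_boot all_order all_fingroup all_algebra.
From mathcomp Require Import reals complex ring lra zify.

(** Write A for the adjacency operator, s for the square root of q and
Y = A / (2s). In the eigenbasis psi the operator M = bL - a (L the Laplacian)
is diagonal with entries mu_j, so both sides of the claim compute M^k: the left
one through psi ([spectral_power]; [spectral_trace] for the trace), the right
one through a polynomial in A. Indeed L = (q+1) - A gives M = d - bA = d(1 - cY).

With X = (z + 1/z)/2 one has T_m(X) = (z^m + z^-m)/2, and I_n^c(k) is the
coefficient of z^n in (1 + (c/2)(z + 1/z))^k; hence
    (1 - cX)^k = I_0^c(k) + 2 sum_(1 <= m <= k) (-1)^m I_m^c(k) T_m(X),
which is [chebyshev_besselI]. It is proved without z: the coefficients obey
the three-term recurrences [besselI0S] and [besselISS], dual to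
2 X T_(m+1) = T_(m+2) + T_m.

Non-backtracking walks enter since b_m q^(-m/2) = 2 T_m(Y) for m > 0
([nb_coef_mx_chebyshev]). Counting walks by their first step
shows that the matrices C_m of the numbers c_m obey
C_(m+1) = A C_m - q C_(m-1) for m > 1, with the exceptional start
C_2 = A^2 - (q+1). The matrices P_m = 2 s^m T_m(Y) obey the same recurrence,
but start with P_1 = A and P_2 = A^2 - 2q. The correction terms in b_m keep
the recurrence ([nb_coef_mxSSS]) and turn C_2 into C_2 + (1-q) = P_2. *)

Set Implicit Arguments.
Unset Strict Implicit.
Unset Printing Implicit Defensive.

Import Order.TTheory GRing.Theory Num.Theory.
Local Open Scope ring_scope.
Local Open Scope complex_scope.

(** * Recurrences for the discrete Bessel function *)

(** The trinomial coefficient factors into two binomials. They vanish on their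
own beyond the range of the defining sum, so one bound L serves all orders n at
once and the sums can be compared termwise. *)
Lemma besselI_bin (F : numFieldType) (n : nat) (c : F) (t L : nat) :
  (t < L)%N ->
  besselI n c t = \sum_(0 <= l < L)
    ('C(t, l.*2 + n) * 'C(l.*2 + n, l))%:R * (c / 2%:R) ^+ (l.*2 + n).
Proof.
move=> tL; rewrite /besselI; case: leqP => [nt|tn]; last first.
  by rewrite big1 // => l _; rewrite bin_small ?mul0n ?mul0r //; lia.
rewrite (@big_cat_nat _ _ _ ((t - n)./2).+1 0 L) //=; last by lia.
rewrite [X in _ = _ + X]big_nat_cond [X in _ = _ + X]big1 ?addr0; last first.
  by move=> l hl; rewrite bin_small ?mul0n ?mul0r //; lia.
apply: eq_big_nat => l /andP[_ hl]; congr (_ * _).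
have le1 : (l.*2 + n <= t)%N by lia.
have le2 : (l <= l.*2 + n)%N by lia.
have f_neq0 m : m`!%:R != 0 :> F by rewrite pnatr_eq0 -lt0n fact_gt0.
have E1 : (t - l.*2 - n = t - (l.*2 + n))%N by lia.
have E2 : (n + l = l.*2 + n - l)%N by lia.
have := bin_fact le1; have := bin_fact le2; rewrite E1 E2 => <- <-.
rewrite !natrM; field; rewrite !f_neq0 //.
Qed.

Lemma besselI_gt (F : numFieldType) (n : nat) (c : F) (t : nat) :
  (t < n)%N -> besselI n c t = 0.
Proof. by rewrite /besselI ltnNge => /negPf ->. Qed.

Lemma besselI_t0 (F : numFieldType) (c : F) : besselI 0 c 0 = 1.
Proof. by rewrite (@besselI_bin _ _ _ _ 1) // big_nat1 mul1r. Qed.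

(** Separate from [besselISS] because the term of order -1 is folded back onto
order 1; termwise this is C(2l+2, l+1) = 2 C(2l+1, l). *)
Lemma besselI0S (F : numFieldType) (c : F) (t : nat) :
  besselI 0 c t.+1 = besselI 0 c t + c * besselI 1 c t.
Proof.
rewrite (@besselI_bin _ 0 c t.+1 t.+2) // (@besselI_bin _ 0 c t t.+2) //.
rewrite !(big_nat_recl t.+1) //= -addrA (@besselI_bin _ 1 c t t.+1) //.
congr (_ + _); first by rewrite !addn0 !bin0.
rewrite mulr_sumr -big_split /=; apply: eq_big_nat => l _.
have central : 'C(l.*2.+2, l.+1) = (2 * 'C(l.*2.+1, l))%N.
  have : (l <= l.*2.+1)%N by lia.
  move=> /bin_sub; rewrite (_ : l.*2.+1 - l = l.+1)%N; last by lia.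
  by move=> sym; rewrite binS sym mul2n addnn.
rewrite doubleS !addn0 addn1 central binS !natrM natrD exprS.
by field.
Qed.

(** Pascal's rule on the first binomial of each term leaves the sum for order
n+1 at time t and a second sum; Pascal's rule on the other binomial splits that
one into order n and, with l shifted by one, order n+2. *)
Lemma besselISS (F : numFieldType) (n : nat) (c : F) (t : nat) :
  besselI n.+1 c t.+1 = besselI n.+1 c t
     + c / 2%:R * (besselI n c t + besselI n.+2 c t).
Proof.
rewrite (@besselI_bin _ n.+1 c t.+1 t.+2) // (@besselI_bin _ n.+1 c t t.+2) //.
rewrite (@besselI_bin _ n c t t.+2) // !(big_nat_recl t.+1) //.
rewrite (@besselI_bin _ n.+2 c t t.+1) // !double0 !add0n !bin0 !muln1 mulrDr mulrDr.
rewrite binS natrD exprS; set h := c / 2%:R.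
(* With the terms l = 0 set aside, the sums left over for orders n and n+1
   are indexed by l+1, while the sum for order n+2 is indexed by l. *)
rewrite (_ : \sum_(0 <= l < t.+1) _ =
   \sum_(0 <= l < t.+1)
     ('C(t, l.+1.*2 + n.+1) * 'C(l.+1.*2 + n.+1, l.+1))%:R
        * h ^+ (l.+1.*2 + n.+1)
   + h * (\sum_(0 <= l < t.+1)
       ('C(t, l.+1.*2 + n) * 'C(l.+1.*2 + n, l.+1))%:R * h ^+ (l.+1.*2 + n))
   + h * (\sum_(0 <= l < t.+1)
       ('C(t, l.*2 + n.+2) * 'C(l.*2 + n.+2, l))%:R * h ^+ (l.*2 + n.+2))).
  by ring.
rewrite !mulr_sumr -!big_split /=; apply: eq_big_nat => l _.
rewrite (_ : l.+1.*2 + n = l.*2 + n.+2)%N; last by lia.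
rewrite (_ : l.+1.*2 + n.+1 = (l.*2 + n.+2).+1)%N; last by lia.
by rewrite !binS !(natrM, natrD) exprS; ring.
Qed.

(** * Chebyshev expansion of powers *)

#[local] Arguments chebyshevT R m : simpl never.

Lemma chebyshev_step (R : comNzRingType) (m : nat) :
  'X * chebyshevT R m.+1 *+ 2 = chebyshevT R m.+2 + chebyshevT R m.
Proof.
rewrite -[chebyshevT R m.+2]/(2%:R *: 'X * chebyshevT R m.+1 - chebyshevT R m).
by rewrite subrK scaler_nat mulrnAl.
Qed.

(** Multiplying the expansion by 1 - cX changes the signed coefficients
u_m = (-1)^m I_m^c(k) exactly as the Bessel recurrences do, since
2 X T_(m+1) = T_(m+2) + T_m. *)
Lemma chebyshev_besselI (F : numFieldType) (c : F) (k : nat) :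
  (1 - c *: 'X) ^+ k = (besselI 0 c k)%:P
    + \sum_(0 <= m < k)
        ((-1) ^+ m.+1 * besselI m.+1 c k)%:P * chebyshevT F m.+1 *+ 2.
Proof.
elim: k => [|k IH]; first by rewrite big_geq // besselI_t0 addr0.
pose u m := (-1) ^+ m * besselI m c k.
have uk m : (k < m)%N -> u m = 0 by move=> km; rewrite /u besselI_gt ?mulr0.
pose T := chebyshevT F.
have -> : besselI 0 c k.+1 = u 0 - c * u 1.
  by rewrite besselI0S /u; ring.
have uS m : (-1) ^+ m.+1 * besselI m.+1 c k.+1
     = u m.+1 - c / 2%:R * (u m + u m.+2).
  by rewrite besselISS /u !exprS; ring.
under eq_bigr do rewrite uS.
have two_half : (c / 2%:R)%:P *+ 2 = c%:P :> {poly F}.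
  by rewrite -polyCMn -[_ *+ 2]mulr_natr divfK // pnatr_eq0.
rewrite exprSr IH -/(u 0) -mul_polyC.
have -> : besselI 0 c k = u 0 by rewrite /u; ring.
set S := \sum_(0 <= m < k) _.
have shift0 : \sum_(0 <= m < k.+1) (u m)%:P * T m.+1
     = (u 0)%:P * 'X + \sum_(0 <= m < k) (u m.+1)%:P * T m.+2.
  by rewrite big_nat_recl.
(* The terms beyond k vanish, so the shifted range may be enlarged freely;
   u_1 is the coefficient of T_0 = 1. *)
have shift1 : (u 1)%:P + \sum_(0 <= m < k.+1) (u m.+2)%:P * T m.+1
     = \sum_(0 <= m < k) (u m.+1)%:P * T m.
  rewrite -[X in X + _]mulr1 -[X in _ * X]/(T 0%N).
  rewrite -(@big_nat_recl _ _ _ k.+1 0 (fun m => (u m.+1)%:P * T m)) //.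
  rewrite !big_nat_recr //= !uk //.
  by rewrite !mul0r !addr0.
have shift2 : \sum_(0 <= m < k.+1) (u m.+1)%:P * T m.+1 *+ 2 = S.
  by rewrite big_nat_recr //= uk // !mul0r mul0rn addr0.
have XS : 'X * S = \sum_(0 <= m < k) (u m.+1)%:P * T m.+2
                 + \sum_(0 <= m < k) (u m.+1)%:P * T m.
  rewrite /S mulr_sumr -big_split /=; apply: eq_bigr => m _.
  by rewrite -mulrDr -chebyshev_step /u -/T; ring.
rewrite -shift1 in XS.
transitivity ((u 0)%:P - c%:P * (u 1)%:P + S - c%:P *
  (\sum_(0 <= m < k.+1) (u m)%:P * T m.+1 +
   \sum_(0 <= m < k.+1) (u m.+2)%:P * T m.+1)); last first.
  rewrite -shift2 !polyCB -!addrA; congr (_ + (_ + _)); first by rewrite (polyCM c).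
  rewrite -big_split /= mulr_sumr -sumrB; apply: eq_bigr => m _.
  by rewrite -/T -two_half polyCB (polyCM (c / 2%:R)) polyCD; ring.
rewrite shift0 mulrBr mulr1 mulrDl.
have -> : S * (c%:P * 'X) = c%:P * ('X * S) by ring.
by rewrite XS; ring.
Qed.

(** * Non-backtracking walks *)

Lemma card_tuple0 (V : finType) (P : pred (seq V)) :
  #|[set p : 0.-tuple V | P p]| = P [::].
Proof.
case: (boolP (P [::])) => hP /=.
  rewrite (_ : [set p | _] = setT) ?cardsT ?card_tuple ?expn0 //.
  by apply/setP => p; rewrite !inE tuple0.
apply/eqP; rewrite cards_eq0; apply/eqP/setP => p.
by rewrite !inE tuple0 (negPf hP).
Qed.

Lemma card_tupleS (V : finType) (m : nat) (P : pred (seq V)) :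
  #|[set p : m.+1.-tuple V | P p]|
    = (\sum_(y : V) #|[set p : m.-tuple V | P (y :: p)]|)%N.
Proof.
rewrite -sum1dep_card (reindex (fun yp : V * m.-tuple V =>
  [tuple of yp.1 :: yp.2])) /=; last first.
  exists (fun p => (thead p, [tuple of behead p])).
    by case=> y p _ /=; rewrite theadE; congr (_, _); apply: val_inj.
  by move=> p _ /=; rewrite -tuple_eta.
under [RHS]eq_bigr do rewrite -sum1dep_card.
by rewrite (pair_big_dep xpredT (fun y (p : m.-tuple V) => P (y :: p))).
Qed.

Section NonBacktracking.
Variables (V : finType) (e : rel V) (x : V).

(** Walks from v to x of length m that may be prefixed by the dart (u, v). The
dart itself need not be an edge: it only records which first step is banned.
*)
Definition nb_continuations (m : nat) (u v : V) : nat :=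
  #|[set p : m.-tuple V | [&& path e v p, last v p == x &
      path (fun d d' : V * V => d' != (d.2, d.1)) (u, v) (darts v p)]]|.

Lemma nb_continuations0 (u v : V) : nb_continuations 0 u v = (v == x).
Proof.
rewrite /nb_continuations (card_tuple0 (fun p => [&& path e v p, last v p == x &
      path (fun d d' : V * V => d' != (d.2, d.1)) (u, v) (darts v p)])).
by rewrite /= andbT.
Qed.

Lemma nb_walks0 (u : V) : nb_walks e u 0 x = (u == x).
Proof.
rewrite /nb_walks (card_tuple0 (fun p =>
  [&& path e u p, last u p == x & nonbacktracking u p])).
by rewrite /= andbT.
Qed.

Lemma nb_walksS (m : nat) (u : V) :
  nb_walks e u m.+1 x = (\sum_(v | e u v) nb_continuations m u v)%N.
Proof.
rewrite /nb_walks (card_tupleS m (fun p =>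
  [&& path e u p, last u p == x & nonbacktracking u p])) [RHS]big_mkcond.
apply: eq_bigr => v _ /=; case: (e u v) => //=.
by apply: eq_card0 => p; rewrite !inE.
Qed.

Lemma nb_continuationsS (m : nat) (u v : V) :
  nb_continuations m.+1 u v
    = (\sum_(y | e v y && (y != u)) nb_continuations m v y)%N.
Proof.
rewrite /nb_continuations (card_tupleS m (fun p => [&& path e v p, last v p == x &
      path (fun d d' : V * V => d' != (d.2, d.1)) (u, v) (darts v p)])).
rewrite [RHS]big_mkcond; apply: eq_bigr => y _ /=.
rewrite xpair_eqE eqxx /=; case: (e v y) => /=; last first.
  by apply: eq_card0 => p; rewrite !inE.
case: (y != u) => //=.
by apply: eq_card0 => p; rewrite !inE !andbF.
Qed.

Hypothesis e_sym : symmetric e.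

(** A walk of length m+1 from v either may follow the dart (u, v), or steps first
to u; in the latter case what remains may follow the dart (v, u). *)
Lemma nb_continuationsS_nb_walks (m : nat) (u v : V) : e u v ->
  (nb_continuations m.+1 u v + nb_continuations m v u)%N
    = nb_walks e v m.+1 x.
Proof.
move=> euv; rewrite nb_continuationsS nb_walksS [RHS](bigD1 u) ?(e_sym v) //=.
by rewrite addnC.
Qed.

Lemma nb_walksSS (m : nat) (u : V) :
  (nb_walks e u m.+2 x + \sum_(v | e u v) nb_continuations m v u)%N
    = (\sum_(v | e u v) nb_walks e v m.+1 x)%N.
Proof.
rewrite nb_walksS -big_split; apply: eq_bigr => v euv.
exact: nb_continuationsS_nb_walks.
Qed.

Variable q : nat.
Hypothesis e_reg : regular_graph e q.+1.

Lemma sum_neighbours (u : V) (k : nat) : (\sum_(v | e u v) k = q.+1 * k)%N.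
Proof. by rewrite sum_nat_const -(e_reg u) cardsE. Qed.

(** The term q+1 rather than q: a walk of length 0 has no first step, so none of
the q+1 detours of length 2 in front of it is excluded. *)
Lemma nb_walks2 (u : V) :
  (nb_walks e u 2 x + q.+1 * (u == x))%N = (\sum_(v | e u v) nb_walks e v 1 x)%N.
Proof.
rewrite -nb_walksSS -(sum_neighbours u); congr addn.
by apply: eq_bigr => v _; rewrite nb_continuations0.
Qed.

(** Prefix a non-backtracking walk by an edge from u. The result backtracks
exactly when it is a walk of length m+1 from u with a detour to a neighbour
in front; the detour must avoid the first step of that walk, which leaves q
choices. *)
Lemma nb_walksSSS (m : nat) (u : V) :
  (nb_walks e u m.+3 x + q * nb_walks e u m.+1 x)%N
    = (\sum_(v | e u v) nb_walks e v m.+2 x)%N.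
Proof.
rewrite -nb_walksSS; congr addn; apply/eqP.
rewrite -(eqn_add2r (nb_walks e u m.+1 x)) addnC -mulSn -(sum_neighbours u).
rewrite {2}nb_walksS -big_split /=; apply/eqP; apply: eq_bigr => v euv.
by rewrite nb_continuationsS_nb_walks // e_sym.
Qed.

End NonBacktracking.

(** Consecutive coefficients of equal parity telescope, which replaces the sum in
the definition by a recurrence. *)
Lemma nb_coefSS (V : finType) (e : rel V) (q : nat) (x0 : V) (m : nat) (x : V) :
  nb_coef e q x0 m.+2 x = nb_coef e q x0 m x
    + (nb_walks e x0 m.+2 x)%:Z - q%:Z * (nb_walks e x0 m x)%:Z.
Proof.
(* The second branch of the definition also covers k < 2: its sum is empty. *)
have coefE k : nb_coef e q x0 k x = (nb_walks e x0 k x)%:Z +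
    (1 - q%:Z) * \sum_(1 <= i < k./2.+1) (nb_walks e x0 (k - i.*2) x)%:Z.
  by rewrite /nb_coef; case: k => [|[|k]] //=; rewrite big_geq // mulr0 addr0.
rewrite !coefE /= big_ltn // big_add1 /= !subSS subn0.
by under eq_bigr do rewrite doubleS !subSS; ring.
Qed.

(** * Matrices of walk counts *)

Section Matrices.
Variables (V : finType) (n : nat) (cardV : #|V| = n.+1).

Lemma vertex_indexK : cancel (vertex_index cardV) (index_vertex cardV).
Proof. by move=> x; rewrite /index_vertex cast_ordK enum_rankK. Qed.

Lemma index_vertexK : cancel (index_vertex cardV) (vertex_index cardV).
Proof. by move=> i; rewrite /vertex_index enum_valK cast_ordKV. Qed.

Lemma sum_index_vertex (Z : nmodType) (P : pred V) (f : V -> Z) :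
  \sum_(i | P (index_vertex cardV i)) f (index_vertex cardV i)
    = \sum_(x | P x) f x.
Proof.
rewrite [RHS](reindex (index_vertex cardV)) //.
by apply: onW_bij; exists (vertex_index cardV);
  [exact: index_vertexK | exact: vertex_indexK].
Qed.

Variables (R : comNzRingType) (e : rel V).
Local Notation A := (adjacency_mx cardV R e).

Lemma adjacency_mul (k : nat) (X : 'M[R]_(n.+1, k)) i j :
  (A *m X) i j = \sum_(l | e (index_vertex cardV i) (index_vertex cardV l)) X l j.
Proof.
rewrite mxE [RHS]big_mkcond; apply: eq_bigr => l _.
by rewrite mxE; case: (e _ _); rewrite ?mul1r ?mul0r.
Qed.

Lemma adjacency_tr : symmetric e -> A^T = A.
Proof. by move=> e_sym; apply/matrixP => i j; rewrite !mxE e_sym. Qed.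

Definition nb_walk_mx (m : nat) : 'M[R]_n.+1 := \matrix_(i, j)
  (nb_walks e (index_vertex cardV i) m (index_vertex cardV j))%:R.

Definition nb_coef_mx (q m : nat) : 'M[R]_n.+1 := \matrix_(i, j)
  (nb_coef e q (index_vertex cardV i) m (index_vertex cardV j))%:~R.

Local Notation C := nb_walk_mx.

Lemma nb_walk_mx0 : C 0 = 1%:M.
Proof.
apply/matrixP => i j; rewrite !mxE nb_walks0.
by rewrite (can_eq index_vertexK).
Qed.

Lemma nb_walk_mx1 : C 1 = A.
Proof.
apply/matrixP => i j; rewrite !mxE nb_walksS; congr (_%:R).
under eq_bigr do rewrite nb_continuations0.
rewrite big_mkcond (bigD1 (index_vertex cardV j)) //= eqxx big1 ?addn0.
  by case: (e _ _).
by move=> v /negPf->; case: (e _ _).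
Qed.

Lemma adjacency_nb_walk_mx m i j : (A *m C m) i j =
  (\sum_(v | e (index_vertex cardV i) v)
     nb_walks e v m (index_vertex cardV j))%N%:R.
Proof.
rewrite adjacency_mul natr_sum -(sum_index_vertex (e _)).
by apply: eq_bigr => l _; rewrite mxE.
Qed.

Hypothesis e_sym : symmetric e.
Variable q : nat.
Hypothesis e_reg : regular_graph e q.+1.

Local Notation B := (nb_coef_mx q).

Lemma nb_walk_mx2 : C 2 = A *m C 1 - q.+1%:R *: C 0.
Proof.
apply/eqP; rewrite eq_sym subr_eq; apply/eqP/matrixP => i j.
rewrite adjacency_nb_walk_mx -(nb_walks2 _ e_sym e_reg) !mxE nb_walks0.
by rewrite natrD natrM.
Qed.

Lemma nb_walk_mxSSS m : C m.+3 = A *m C m.+2 - q%:R *: C m.+1.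
Proof.
apply/eqP; rewrite eq_sym subr_eq; apply/eqP/matrixP => i j.
by rewrite adjacency_nb_walk_mx -(nb_walksSSS _ e_sym e_reg) !mxE natrD natrM.
Qed.

Lemma nb_coef_mx0 : B 0 = C 0.
Proof. by apply/matrixP => i j; rewrite !mxE. Qed.

Lemma nb_coef_mx1 : B 1 = C 1.
Proof. by apply/matrixP => i j; rewrite !mxE. Qed.

Lemma nb_coef_mxSS m : B m.+2 = B m + C m.+2 - q%:R *: C m.
Proof.
apply/matrixP => i j; rewrite !mxE nb_coefSS rmorphB rmorphD rmorphM /=.
by rewrite -!pmulrn.
Qed.

(** Substituting B_(k+2) = B_k + C_(k+2) - q C_k reduces the case m+2 to the
case m and to the recurrence of C. For m = 1 the recurrence does not reach B_2;
there the exceptional value of C_2 makes the remaining terms cancel, because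
1 - q^2 = (1 - q)(q + 1). *)
Lemma nb_coef_mxSSS m : B m.+3 = A *m B m.+2 - q%:R *: B m.+1.
Proof.
have AC0 : A *m C 0 = C 1 by rewrite nb_walk_mx0 mulmx1 nb_walk_mx1.
have AB k : A *m B k.+2 = A *m B k + A *m C k.+2 - q%:R *: (A *m C k).
  by rewrite nb_coef_mxSS mulmxBr mulmxDr -scalemxAr.
elim/ltn_ind: m => -[|[|m]] IH.
- rewrite AB nb_coef_mx0 nb_coef_mxSS nb_walk_mxSSS nb_coef_mx1 AC0.
  by apply/matrixP => i j; rewrite !mxE; ring.
- rewrite AB nb_coef_mx1 !nb_coef_mxSS nb_walk_mxSSS nb_coef_mx0.
  rewrite nb_walk_mx2; move: (A *m C 1) (A *m C 3) (C 0) => X Y Z.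
  by apply/matrixP => i j; rewrite !mxE -[q.+1%:R]natr1; ring.
- have IHm := IH m (ltnW (ltnSn _)).
  rewrite AB [B m.+4.+1]nb_coef_mxSS {1}IHm [B m.+3]nb_coef_mxSS.
  rewrite [C m.+4.+1]nb_walk_mxSSS [C m.+3]nb_walk_mxSSS.
  move: (A *m B m.+2) (A *m C m.+4) (A *m C m.+2) (B m.+1) (C m.+1).
  move=> X Y Z S T.
  by apply/matrixP => i j; rewrite !mxE; ring.
Qed.

End Matrices.

(** * Walk coefficients as Chebyshev polynomials of the adjacency matrix *)

Section Chebyshev.
Variables (V : finType) (n : nat) (cardV : #|V| = n.+1).
Variables (F : numFieldType) (e : rel V) (q : nat) (s : F).
Hypotheses (s_sqr : s ^+ 2 = q%:R) (s_neq0 : s != 0).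
Hypotheses (e_sym : symmetric e) (e_reg : regular_graph e q.+1).

Local Notation A := (adjacency_mx cardV F e).
Local Notation TA m := (horner_mx ((2%:R * s)^-1 *: A) (chebyshevT F m)).

(** The factor 2 s^m clears the denominators: the Chebyshev recurrence becomes
the recurrence of the matrices B_m. *)
Lemma horner_chebyshevSS m :
  (2%:R * s ^+ m.+2) *: TA m.+2
    = A *m ((2%:R * s ^+ m.+1) *: TA m.+1) - q%:R *: ((2%:R * s ^+ m) *: TA m).
Proof.
have two_neq0 : 2%:R != 0 :> F by rewrite pnatr_eq0.
have -> : TA m.+2 = s^-1 *: (A *m TA m.+1) - TA m.
  apply/eqP; rewrite eq_sym subr_eq -rmorphD /= -chebyshev_step rmorphMn rmorphM /=.
  rewrite horner_mx_X -[X in _ == X]scaler_nat -scalerAl scalerA; apply/eqP.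
  by congr (_ *: _); field; rewrite s_neq0.
rewrite -scalemxAr -s_sqr scalerBr !scalerA.
by congr (_ *: _ - _ *: _); rewrite !exprS; field.
Qed.

(** Both sides obey the same recurrence. The identity fails at index 0, where
B_0 = 1 while 2 T_0 = 2; so the two start values are those at 1 and 2. *)
Lemma nb_coef_mx_chebyshev m :
  nb_coef_mx cardV F e q m.+1 = (2%:R * s ^+ m.+1) *: TA m.+1.
Proof.
have two_neq0 : 2%:R != 0 :> F by rewrite pnatr_eq0.
have P0 : (2%:R * s ^+ 0) *: TA 0 = 2%:R *: 1%:M by rewrite rmorph1 mulr1.
have P1 : (2%:R * s ^+ 1) *: TA 1 = A.
  by rewrite horner_mx_X scalerA expr1 divff ?scale1r // mulf_neq0.
elim/ltn_ind: m => -[|[|m]] IH.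
- by rewrite nb_coef_mx1 nb_walk_mx1 P1.
- rewrite nb_coef_mxSS (nb_walk_mx2 _ _ e_sym e_reg) nb_walk_mx1 nb_coef_mx0 nb_walk_mx0.
  rewrite horner_chebyshevSS P0 P1; move: (A *m A) (1%:M) => X Y.
  by apply/matrixP => i j; rewrite !mxE -[q.+1%:R]natr1; ring.
- by rewrite nb_coef_mxSSS // horner_chebyshevSS !IH.
Qed.

End Chebyshev.

Lemma horner_mx_tr (R : comNzRingType) (n : nat) (M : 'M[R]_n.+1) (p : {poly R}) :
  (horner_mx M p)^T = horner_mx M^T p.
Proof.
elim/poly_ind: p => [|p a IH]; first by rewrite !rmorph0 trmx0.
rewrite !rmorphD !rmorphM /= !horner_mx_X !horner_mx_C linearD /= tr_scalar_mx.
congr (_ + _); rewrite -mulmxE trmx_mul IH.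
exact/esym/comm_horner_mx.
Qed.

(** Since d - bA = d (1 - cY), the polynomial expansion is evaluated at Y. *)
Lemma affine_mx_power (F : numFieldType) (n : nat) (A : 'M[F]_n.+1)
    (s b d : F) (k : nat) :
  s != 0 -> d != 0 ->
  let c := 2%:R * b * s / d in
  let TA := fun m => horner_mx ((2%:R * s)^-1 *: A) (chebyshevT F m) in
  (d%:M - b *: A) ^+ k = d ^+ k *: (besselI 0 c k *: 1%:M
    + 2%:R *: \sum_(1 <= m < k.+1) ((-1) ^+ m * besselI m c k) *: TA m).
Proof.
move=> s_neq0 d_neq0 c TA; have two_neq0 : 2%:R != 0 :> F by rewrite pnatr_eq0.
set Y := (2%:R * s)^-1 *: A.
have -> : d%:M - b *: A = d *: horner_mx Y (1 - c *: 'X).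
  rewrite rmorphB rmorph1 /= horner_mxZ horner_mx_X scalerBr !scalerA.
  rewrite scalemx1; congr (_ - _ *: _).
  by rewrite /c; field; rewrite s_neq0 d_neq0.
rewrite exprZn -rmorphXn /= chebyshev_besselI; congr (_ *: _).
rewrite rmorphD /= horner_mx_C scalemx1; congr (_ + _).
rewrite rmorph_sum big_add1 /= scaler_sumr; apply: eq_bigr => m _.
by rewrite rmorphMn rmorphM /= horner_mx_C -mulmxE mul_scalar_mx -scaler_nat.
Qed.

(** * Spectral side *)

Section Spectral.
Variables (R : realType) (V : finType) (n : nat) (cardV : #|V| = n.+1).
Variable psi : 'I_n.+1 -> V -> R[i].
Hypothesis psi_on : orthonormal_family psi.

(** There are as many functions psi_j as vertices, so their matrix is square and
a one-sided inverse is two-sided. *)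
Lemma orthonormal_complete (x y : V) :
  \sum_j psi j x * conjc (psi j y) = (x == y)%:R.
Proof.
pose P : 'M[R[i]]_n.+1 := \matrix_(j, i) psi j (index_vertex cardV i).
pose Q : 'M[R[i]]_n.+1 := \matrix_(i, j) conjc (psi j (index_vertex cardV i)).
have /mulmx1C QP : P *m Q = 1%:M.
  apply/matrixP => i j; rewrite !mxE -psi_on.
  rewrite -(sum_index_vertex cardV xpredT (fun x => psi i x * conjc (psi j x))).
  by apply: eq_bigr => l _; rewrite !mxE.
have /matrixP/(_ (vertex_index cardV y) (vertex_index cardV x)) := QP.
rewrite !mxE (can_eq (vertex_indexK cardV)) eq_sym => <-.
by apply: eq_bigr => j _; rewrite !mxE !vertex_indexK mulrC.
Qed.

Variables (M : 'M[R]_n.+1) (mu : 'I_n.+1 -> R).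
Hypothesis psi_eigen : forall (j i : 'I_n.+1),
  \sum_l (M i l)%:C * psi j (index_vertex cardV l)
    = (mu j)%:C * psi j (index_vertex cardV i).

Lemma spectral_power (k : nat) (x y : V) :
  \sum_j (mu j ^+ k)%:C * psi j x * conjc (psi j y)
    = ((M ^+ k) (vertex_index cardV x) (vertex_index cardV y))%:C.
Proof.
elim: k x => [|k IH] x.
  rewrite expr0 mxE (can_eq (vertex_indexK cardV)) rmorph_nat -orthonormal_complete.
  by apply: eq_bigr => j _; rewrite expr0 rmorph1 mul1r.
rewrite exprS mxE rmorph_sum /=.
transitivity (\sum_l \sum_j (M (vertex_index cardV x) l)%:C *
   ((mu j ^+ k)%:C * psi j (index_vertex cardV l) * conjc (psi j y))).
  rewrite exchange_big /=; apply: eq_bigr => j _.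
  rewrite -[x in LHS](vertex_indexK cardV) exprS rmorphM /=.
  rewrite (mulrC (mu j)%:C) -(mulrA _ (mu j)%:C) -psi_eigen mulr_sumr mulr_suml.
  by apply: eq_bigr => l _; ring.
by apply: eq_bigr => l _; rewrite -mulr_sumr IH index_vertexK rmorphM.
Qed.

(** Sum the diagonal entries; each psi_j has norm 1. *)
Lemma spectral_trace (k : nat) : \sum_j mu j ^+ k = \tr (M ^+ k).
Proof.
apply: (@complexI R); rewrite /mxtrace !rmorph_sum /=.
transitivity (\sum_i \sum_j (mu j ^+ k)%:C * psi j (index_vertex cardV i)
    * conjc (psi j (index_vertex cardV i))).
  rewrite exchange_big; apply: eq_bigr => j _.
  rewrite (sum_index_vertex cardV xpredT
    (fun x => (mu j ^+ k)%:C * psi j x * conjc (psi j x))).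
  under eq_bigr do rewrite -mulrA.
  by rewrite -mulr_sumr psi_on eqxx mulr1.
by apply: eq_bigr => i _; rewrite spectral_power index_vertexK.
Qed.

End Spectral.

Lemma affine_laplacian_eigen (R : realType) (V : finType) (n : nat)
    (cardV : #|V| = n.+1) (e : rel V) (q : nat) (a b lam : R) (f : V -> R[i]) :
  (forall x, laplacian e q f x = lam%:C * f x) -> forall i,
  \sum_l (((b * q.+1%:R - a)%:M - b *: adjacency_mx cardV R e) i l)%:C
       * f (index_vertex cardV l)
    = (b * lam - a)%:C * f (index_vertex cardV i).
Proof.
move=> f_eigen i; set x := index_vertex cardV i.
have sumE : \sum_(y | e x y) f y = (q.+1%:R - lam)%:C * f x.
  have := f_eigen x; rewrite /laplacian rmorphB rmorph_nat /= mulrBl => <-; ring.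
under eq_bigr do rewrite !mxE rmorphB rmorphM rmorphMn /= mulrBl.
rewrite sumrB (bigD1 i) //= eqxx big1 ?addr0; last first.
  by move=> l /negPf li; rewrite eq_sym li mul0r.
rewrite (_ : \sum_l _ = b%:C * \sum_(y | e x y) f y); last first.
  rewrite -(sum_index_vertex cardV (e x)) mulr_sumr [RHS]big_mkcond.
  apply: eq_bigr => l _; case: (e x _); first by rewrite mulr1.
  by rewrite mulr0 mul0r.
by rewrite sumE mulr1n !(rmorphB, rmorphM, rmorph_nat) /=; ring.
Qed.

(** * The pre-trace and trace formulas *)

Theorem theorem1p2 (R : realType) (q n : nat) (V : finType) (e : rel V)
    (x0 : V) (cardV : #|V| = n.+1)
    (lam : 'I_n.+1 -> R) (psi : 'I_n.+1 -> V -> R[i]) (a b : R) :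
  (1 <= q)%N ->
  simple_graph e -> connected_graph e -> regular_graph e q.+1 ->
  lam ord0 = 0 ->
  (forall i j : 'I_n.+1, (i <= j)%N -> lam i <= lam j) ->
  (forall (j : 'I_n.+1) (x : V),
      laplacian e q (psi j) x = (lam j)%:C * psi j x) ->
  orthonormal_family psi ->
  b != 0 ->
  (0 < b -> a <= 0) ->
  (b < 0 -> a <= - `|b| * Num.max (lam ord_max) ((Num.sqrt q%:R + 1) ^+ 2)) ->
  let c := 2%:R * b * Num.sqrt q%:R / (b * q.+1%:R - a) in
  let d := b * q.+1%:R - a in
  let mu := fun j : 'I_n.+1 => b * lam j - a in
  let TA := fun m : nat =>
    horner_mx ((2%:R * Num.sqrt q%:R)^-1 *: adjacency_mx cardV R e)
              (chebyshevT R m) in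
  [/\ forall j : 'I_n.+1, 0 <= mu j,
      forall (k : nat) (x : V), (0 < k)%N ->
        \sum_(j < n.+1) (mu j ^+ k)%:C * psi j x0 * conjc (psi j x) =
          (d ^+ k * \sum_(0 <= m < k.+1)
             (-1) ^+ m * (nb_coef e q x0 m x)%:~R * Num.sqrt q%:R ^- m
               * besselI m c k)%:C
        /\
        d ^+ k * (\sum_(0 <= m < k.+1)
             (-1) ^+ m * (nb_coef e q x0 m x)%:~R * Num.sqrt q%:R ^- m
               * besselI m c k) =
          d ^+ k * ((x == x0)%:R * besselI 0 c k
             + 2%:R * \sum_(1 <= m < k.+1)
                 (-1) ^+ m
                 * vertex_entry cardV (TA m *m vertex_delta cardV R x0) x
                 * besselI m c k)
    & vertex_transitive e ->
      forall k : nat, (0 < k)%N ->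
        \sum_(j < n.+1) mu j ^+ k =
          d ^+ k * (n.+1%:R * besselI 0 c k
             + 2%:R * \sum_(1 <= m < k.+1)
                 (-1) ^+ m * \tr (TA m) * besselI m c k)].
Proof.
move=> q_ge1 [e_sym _] _ e_reg lam0 lam_mono psi_eigen psi_on b_neq0 ab_pos ab_neg.
move=> c d mu TA.
set s := Num.sqrt q%:R.
have s_sqr : s ^+ 2 = q%:R by rewrite sqr_sqrtr ?ler0n.
have s_gt0 : 0 < s by rewrite sqrtr_gt0 ltr0n.
have s_neq0 : s != 0 by rewrite gt_eqF.
have lam_ge0 j : 0 <= lam j by rewrite -lam0 lam_mono.
have lam_max j : lam j <= lam ord_max by rewrite lam_mono // -ltnS ltn_ord.
have q1E : q.+1%:R = s ^+ 2 + 1 by rewrite s_sqr natr1.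
(* For b < 0 the bound on a by (s + 1)^2 gives d >= 2 |b| s > 0, and the
   bound by the largest eigenvalue gives mu >= 0. *)
have [d_gt0 mu_ge0] : 0 < d /\ forall j, 0 <= mu j.
  rewrite /d /mu q1E.
  move: b_neq0; rewrite neq_lt => /orP[b_lt0|b_gt0].
  - have := ab_neg b_lt0; rewrite ltr0_norm // opprK -/s => a_le.
    have max_lam : lam ord_max <= Num.max (lam ord_max) ((s + 1) ^+ 2).
      by rewrite le_max lexx.
    have max_s : (s + 1) ^+ 2 <= Num.max (lam ord_max) ((s + 1) ^+ 2).
      by rewrite le_max lexx orbT.
    split=> [|j]; first by nra.
    by have := lam_max j; nra.
  - have a_le0 := ab_pos b_gt0.
    split=> [|j]; first by nra.
    by have := lam_ge0 j; nra.
have d_neq0 : d != 0 by rewrite gt_eqF.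
set A := adjacency_mx cardV R e in TA *.
pose M := d%:M - b *: A.
have M_eigen j i := affine_laplacian_eigen cardV a b (psi_eigen j) i.
have M_power k : M ^+ k = d ^+ k *: (besselI 0 c k *: 1%:M
    + 2%:R *: \sum_(1 <= m < k.+1) ((-1) ^+ m * besselI m c k) *: TA m).
  exact: affine_mx_power.
have TA_sym m : (TA m)^T = TA m.
  by rewrite /TA horner_mx_tr linearZ /= adjacency_tr.
(* The walk matrices are indexed (x0, x), but the column of x0 has entry
   (x, x0); symmetry of the matrices reconciles the two. *)
have vertex_entryE m x : vertex_entry cardV (TA m *m vertex_delta cardV R x0) x
    = TA m (vertex_index cardV x0) (vertex_index cardV x).
  rewrite -[in RHS]TA_sym /vertex_entry !mxE (bigD1 (vertex_index cardV x0)) //=.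
  rewrite mxE eqxx mulr1 big1 ?addr0 // => l /negPf l_neq.
  by rewrite mxE l_neq mulr0.
have nb_coefE m x : (nb_coef e q x0 m.+1 x)%:~R * s ^- m.+1
    = 2%:R * vertex_entry cardV (TA m.+1 *m vertex_delta cardV R x0) x.
  have /matrixP := nb_coef_mx_chebyshev cardV s_sqr s_neq0 e_sym e_reg m.
  move/(_ (vertex_index cardV x0) (vertex_index cardV x)).
  rewrite [LHS]mxE !vertex_indexK => ->; rewrite vertex_entryE mxE -/(TA m.+1).
  by rewrite mulrAC mulfK ?expf_neq0.
have sum_eq k x : \sum_(0 <= m < k.+1)
      (-1) ^+ m * (nb_coef e q x0 m x)%:~R * s ^- m * besselI m c k
    = (x == x0)%:R * besselI 0 c k + 2%:R * \sum_(1 <= m < k.+1) (-1) ^+ m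
        * vertex_entry cardV (TA m *m vertex_delta cardV R x0) x * besselI m c k.
  rewrite big_ltn // /nb_coef /= nb_walks0 eq_sym mul1r invr1 mulr1.
  congr (_ + _); rewrite mulr_sumr !big_add1 /=; apply: eq_bigr => m _.
  by rewrite -mulrA -(mulrA ((-1) ^+ _)) (mulrA _%:~R) nb_coefE; ring.
split=> // [k x k_gt0|_ k k_gt0].
- split; last by rewrite sum_eq.
  rewrite sum_eq (spectral_power psi_on M_eigen) -/d -/A -/M M_power.
  congr (_%:C); rewrite !mxE summxE (can_eq (vertex_indexK cardV)) (eq_sym x0).
  congr (_ * (_ + 2%:R * _)); first exact: mulrC.
  by apply: eq_bigr => m _; rewrite mxE vertex_entryE; ring.
- rewrite (spectral_trace psi_on M_eigen) -/d -/A -/M M_power.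
  rewrite linearZ linearD linearZ /= mxtrace1 [in \tr (2%:R *: _)]linearZ /=.
  rewrite raddf_sum /=; congr (_ * (_ + 2%:R * _)); first exact: mulrC.
  by apply: eq_bigr => m _; rewrite linearZ /=; ring.
Qed.
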